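(* Let $\mathsf{X}_1$ and $\mathsf{X}_2$ be subshifts over countable alphabets, each equipped with the product metric $d$ and the shift map $\sigma$. If $(\mathsf{X}_1,\sigma)$ is isometrically conjugate to $(\mathsf{X}_2,\sigma)$, then the respective OTW-subshifts $\mathsf{X}_1^{OTW}$ and $\mathsf{X}_2^{OTW}$ are conjugate. Moreover, if $\mathsf{X}_1^{OTW}$ and $\mathsf{X}_2^{OTW}$ are conjugate, then $(\mathsf{X}_1,\sigma)$ and $(\mathsf{X}_2,\sigma)$ are conjugate.
   Context: An alphabet is a non-empty, possibly infinite set $\mathscr{A}$; $\mathscr{A}^*=\bigcup_{k\ge 0}\mathscr{A}^k$ is the set of finite words and $\omega$ is the empty word. A subshift over $\mathscr{A}$ is a set $\mathsf{X}=\mathsf{X}_F\subseteq\mathscr{A}^{\mathbb{N}}$, for some $F\subseteq\mathscr{A}^*$, of all sequences none of whose finite blocks lies in $F$; equivalently, a shift-invariant ($\sigma(\mathsf{X})\subseteq\mathsf{X}$, $\sigma((x_n)_n)=(x_{n+1})_n$) closed subset of $\mathscr{A}^{\mathbb{N}}$ with the product topology of discrete spaces. $\mathcal{L}_{\mathsf{X}}$ is the set of all finite words occurring in elements of $\mathsf{X}$ (including $\omega$). The product metric on $\mathscr{A}^{\mathbb{N}}$ is $d((x_n),(y_n))=\frac{1}{2^k}$, where $k$ is such that $x_i=y_i$ for $i=0,\dots,k-1$ and $x_k\ne y_k$ (and $d(x,x)=0$). Two subshifts $(\mathsf{X}_1,\sigma)$, $(\mathsf{X}_2,\sigma)$ are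 conjugate if there is a homeomorphism $\mathsf{X}_1\to\mathsf{X}_2$ (for the topologies induced by $d$) commuting with the shifts, and isometrically conjugate if there is such a map that is in addition an isometry for $d$. OTW-subshifts: if $\mathscr{A}$ is finite, $\mathsf{X}^{OTW}=\mathsf{X}$ with its usual topology and shift. If $\mathscr{A}$ is infinite, $\mathsf{X}^{OTW}=\mathsf{X}\cup\mathsf{X}^{fin}$, where $\mathsf{X}^{fin}$ is the set of finite words $x\in\mathscr{A}^*$ (possibly empty; the empty word is denoted $\vec{0}$) for which there are infinitely many $a\in\mathscr{A}$ such that $xay\in\mathsf{X}$ for some $y\in\mathscr{A}^{\mathbb{N}}$. The topology on $\mathsf{X}^{OTW}$ is generated by the generalised cylinders $\mathcal{Z}(\alpha,G)$ ($\alpha\in\mathcal{L}_{\mathsf{X}}$, $G\subseteq\mathscr{A}$ finite): all $y\in\mathsf{X}^{OTW}$ that begin with $\alpha$ and whose next letter (if any) is not in $G$. The shift $\sigma$ on $\mathsf{X}^{OTW}$ removes the first letter ($\sigma$ of a one-letter word and of $\vec{0}$ is $\vec{0}$). OTW-subshifts $\mathsf{X}_1^{OTW}$, $\mathsf{X}_2^{OTW}$ are conjugate if there is a homeomorphism $\mathsf{X}_1^{OTW}\to\mathsf{X}_2^{OTW}$ that commutes with the shifts and is length-preserving (infinite sequences have length $\infty$). *)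

(* Defs.v *)
From HB Require Import structures.
From mathcomp Require Import all_boot all_order all_algebra.
From mathcomp Require Import all_classical all_reals all_analysis.

Set Implicit Arguments.
Unset Strict Implicit.
Unset Printing Implicit Defensive.

Import Order.TTheory GRing.Theory Num.Theory.
Local Open Scope classical_set_scope.
Local Open Scope ring_scope.

Section Subshift.
Variable A : Type.

Definition seq_shift (x : nat -> A) : nat -> A := fun n => x n.+1.

Definition is_block (w : seq A) (x : nat -> A) : Prop :=
  exists i, w = mkseq (fun k => x (i + k)%N) (size w).

Definition avoiding (F : set (seq A)) : set (nat -> A) :=
  [set x | forall w, is_block w x -> ~ F w].

Record subshift := Subshift {
  subshift_set :> set (nat -> A);
  subshiftP : exists F : set (seq A), subshift_set = avoiding F }.

(* The empty word is in the language even when the subshift is empty. *)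
Definition language (X : set (nat -> A)) : set (seq A) :=
  [set w | w = [::] \/ exists2 x, X x & is_block w x].

(* The concatenation of a finite word with an infinite one: the default value
   of nth is what is read past the end of w. *)
Definition scat (w : seq A) (y : nat -> A) : nat -> A :=
  fun n => nth (y (n - size w)%N) w n.

Definition fin_part (X : set (nat -> A)) : set (seq A) :=
  [set w | infinite_set [set a | exists y, X (scat (rcons w a) y)]].

Lemma subshift_shift (X : subshift) x :
  subshift_set X x -> subshift_set X (seq_shift x).
Proof.
case: X => X [F /= ->] Xx w [i wE]; apply: Xx; exists i.+1.
by rewrite {1}wE; apply: eq_mkseq => k; rewrite /seq_shift addSn.
Qed.

Lemma seq_shift_scat a w y : seq_shift (scat (a :: w) y) = scat w y.
Proof. by apply/funext => n; rewrite /seq_shift /scat /= subSS. Qed.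

Lemma fin_part_behead (X : subshift) w :
  fin_part X w -> fin_part X (behead w).
Proof.
case: w => [//|b w] /= Xw; apply: sub_infinite_set Xw => a [y Xy].
by exists y; rewrite -(seq_shift_scat b); apply: subshift_shift.
Qed.

End Subshift.

(* R, the field in which the product metric takes its values, occurs in the type
   so that the metric structure can be inferred from the type. *)
Definition metric_seq (R : realType) (A : choiceType) : Type := nat -> A.

Section ProductMetric.
Variables (R : realType) (A : choiceType).

HB.instance Definition _ := gen_eqMixin (metric_seq R A).
HB.instance Definition _ := gen_choiceMixin (metric_seq R A).

Definition seq_dist (x y : nat -> A) : R :=
  if pselect (exists k, x k != y k) is left h then 2 ^- ex_minn h else 0.

Lemma seq_distP (x y : nat -> A) :
  (x = y /\ seq_dist x y = 0) \/
  exists k, [/\ forall i, (i < k)%N -> x i = y i, x k <> y k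
    & seq_dist x y = 2 ^- k].
Proof.
rewrite /seq_dist; case: pselect => [h|h]; [right|left].
- case: ex_minnP => k xyk kmin; exists k; split=> //; last exact/eqP.
  by move=> i ik; apply/eqP; apply: contraTT ik => /kmin; rewrite -leqNgt.
- split=> //; apply/funext => k; apply/eqP.
  by apply: contra_notT h => xyk; exists k.
Qed.

Lemma seq_distxx x : seq_dist x x = 0.
Proof. by case: (seq_distP x x) => [[]|[k []]]. Qed.

Lemma seq_dist_eq0 x y : seq_dist x y = 0 -> x = y.
Proof.
case: (seq_distP x y) => [[]//|[k [_ _ ->]]] /eqP.
by rewrite invr_eq0 expf_eq0 pnatr_eq0 andbF.
Qed.

Lemma seq_dist_sym x y : seq_dist x y = seq_dist y x.
Proof.
rewrite /seq_dist; case: pselect => [h|h]; case: pselect => [h'|h'] //.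
- congr (2 ^- _); case: ex_minnP => k xyk kmin; case: ex_minnP => l yxl lmin.
  by apply/eqP; rewrite eqn_leq kmin 1?eq_sym// lmin 1?eq_sym.
- by case: h' => //; case: h => k; exists k; rewrite eq_sym.
- by case: h => //; case: h' => k; exists k; rewrite eq_sym.
Qed.

Lemma seq_dist_ge0 x y : 0 <= seq_dist x y.
Proof.
case: (seq_distP x y) => [[_ ->]//|[k [_ _ ->]]].
by rewrite invr_ge0 exprn_ge0.
Qed.

Lemma seq_dist_triangle y x z :
  seq_dist x z <= seq_dist x y + seq_dist y z.
Proof.
case: (seq_distP x y) => [[-> _]|[k [xyk _ xyE]]].
  by rewrite lerDr seq_dist_ge0.
case: (seq_distP y z) => [[<- _]|[l [yzl _ yzE]]].
  by rewrite lerDl seq_dist_ge0.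
case: (seq_distP x z) => [[_ ->]|[m [_ xzm ->]]].
  by rewrite addr_ge0 ?seq_dist_ge0.
have pow_le i j : (i <= j)%N -> 2 ^- j <= 2 ^- i :> R.
  by move=> ij; rewrite lef_pV2 ?posrE ?exprn_gt0// ler_eXn2l// ltr1n.
case: (leqP k m) => [km|mk].
  by rewrite xyE ler_wpDr ?seq_dist_ge0// pow_le.
case: (leqP l m) => [lm|ml].
  by rewrite yzE ler_wpDl ?seq_dist_ge0// pow_le.
by case: xzm; rewrite xyk// yzl.
Qed.

HB.instance Definition _ := @isMetric.Build R (metric_seq R A)
  seq_dist seq_distxx seq_dist_eq0 seq_dist_sym seq_dist_triangle.

(* The topology of this type is the one mathcomp-analysis puts on the subsets
   of a topological space, here the metric space metric_seq R A. *)
Definition metric_subshift (X : subshift A) : Type :=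
  set_type (subshift_set X : set (metric_seq R A)).

HB.instance Definition _ (X : subshift A) :=
  PseudoMetric.copy (metric_subshift X)
    (set_type (subshift_set X : set (metric_seq R A))).

Lemma metric_shift_subproof (X : subshift A) (x : metric_subshift X) :
  (seq_shift (\val x) : metric_seq R A)
    \in (subshift_set X : set (metric_seq R A)).
Proof. by apply/mem_set/subshift_shift/set_mem/(valP x). Qed.

Definition metric_shift (X : subshift A) (x : metric_subshift X) :
  metric_subshift X :=
  exist (fun y => y \in (subshift_set X : set (metric_seq R A))) _
    (metric_shift_subproof x).

End ProductMetric.

Section Homeomorphism.
Variables S T : topologicalType.

Definition homeomorphism (f : S -> T) : Prop :=
  continuous f /\
  exists g : T -> S, [/\ cancel f g, cancel g f & continuous g].

End Homeomorphism.

Section Conjugacy.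
Variables (R : realType) (A1 A2 : choiceType).
Variables (X1 : subshift A1) (X2 : subshift A2).

Definition conjugacy (f : metric_subshift R X1 -> metric_subshift R X2) :=
  homeomorphism f /\ forall x, f (metric_shift x) = metric_shift (f x).

Definition conjugate : Prop := exists f, conjugacy f.

Definition isometrically_conjugate : Prop :=
  exists2 f, conjugacy f &
    forall x y, mdist (\val (f x)) (\val (f y)) = mdist (\val x) (\val y).

End Conjugacy.

Section OTW.
Variable A : choiceType.

Inductive xword : Type := FinWord of seq A | InfWord of nat -> A.

HB.instance Definition _ := gen_eqMixin xword.
HB.instance Definition _ := gen_choiceMixin xword.

(* None stands for infinite length. *)
Definition xlength (z : xword) : option nat :=
  if z is FinWord w then Some (size w) else None.

Definition xshift (z : xword) : xword :=
  match z with
  | FinWord w => FinWord (behead w)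
  | InfWord x => InfWord (seq_shift x)
  end.

(* The letter at position n, or None past the end of the word. *)
Definition xletter (z : xword) (n : nat) : option A :=
  match z with
  | FinWord w => onth w n
  | InfWord x => Some (x n)
  end.

Definition xprefix (w : seq A) (z : xword) : Prop :=
  forall i, (i < size w)%N -> xletter z i = onth w i.

Definition otw_set (X : subshift A) : set xword :=
  if `[< finite_set [set: A] >] then InfWord @` subshift_set X
  else (InfWord @` subshift_set X) `|` (FinWord @` fin_part (subshift_set X)).

Definition otw (X : subshift A) : Type := set_type (otw_set X).

HB.instance Definition _ X := Choice.copy (otw X) (set_type (otw_set X)).

Definition otw_cylinder (X : subshift A) (w : seq A) (G : set A) :
    set (otw X) :=
  [set z | xprefix w (\val z) /\
    forall a, xletter (\val z) (size w) = Some a -> ~ G a].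

(* For a finite alphabet this is the whole induced product topology, and not
   merely a subbase. *)
Definition otw_subbase (X : subshift A) : set (set (otw X)) :=
  if `[< finite_set [set: A] >] then
    [set U | exists2 V :
         set (prod_topology (fun _ : nat => discrete_topology A)),
       open V & U = [set z | exists2 x, \val z = InfWord x & V x]]
  else
    [set U | exists w G, [/\ language (subshift_set X) w, finite_set G
       & U = otw_cylinder w G]].

HB.instance Definition _ X :=
  isSubBaseTopological.Build (otw X) (@otw_subbase X) id.

Lemma otw_shift_subproof (X : subshift A) (z : otw X) :
  xshift (\val z) \in otw_set X.
Proof.
case: z => z /= /set_mem zX; apply/mem_set; move: zX.
rewrite /otw_set; case: asboolP => _.
  by move=> [x Xx <-]; exists (seq_shift x) => //; exact: subshift_shift.
case=> [[x Xx <-]|[w Xw <-]]; [left|right].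
  by exists (seq_shift x) => //; exact: subshift_shift.
by exists (behead w) => //; exact: fin_part_behead.
Qed.

Definition otw_shift (X : subshift A) (z : otw X) : otw X :=
  exist (fun y => y \in otw_set X) _ (otw_shift_subproof z).

End OTW.

Definition otw_conjugate (A1 A2 : choiceType)
    (X1 : subshift A1) (X2 : subshift A2) : Prop :=
  exists f : otw X1 -> otw X2,
    [/\ homeomorphism f,
        forall z, f (otw_shift z) = otw_shift (f z)
      & forall z, xlength (\val (f z)) = xlength (\val z)].

(* Main.v *)
Require Import Defs.
From mathcomp Require Import all_boot all_order all_algebra.
From mathcomp Require Import all_classical all_reals all_analysis.

Set Implicit Arguments.
Unset Strict Implicit.
Unset Printing Implicit Defensive.

Import Order.TTheory GRing.Theory Num.Theory.
Local Open Scope classical_set_scope.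

(** Both implications compare infinite sequences letter by letter.

    From isometric conjugacy to OTW-conjugacy. Two sequences are at distance
    less than 1 exactly when they have the same first letter, so for an
    equivariant isometry f the first letter of f x is a function phi of the
    first letter of x. Equivariance moves this to every position: f is
    x |-> phi \o x (isometry_letterwise). The inverse of f is given by some
    psi in the same way, and phi and psi are mutually inverse on the letters
    that occur in the two subshifts. Renaming the letters of a finite word by
    phi keeps its length, and keeps infinite the set of letters that can follow
    it because phi is injective on occurring letters. Hence phi acts on
    OTW-subshifts (otw_map). This action is continuous because the inverse
    image of a generalised cylinder contains, around each of its points, the
    generalised cylinder whose word and excluded letters are pulled back along
    psi.

    From OTW-conjugacy to conjugacy. A length-preserving homeomorphism
    restricts to a bijection between the infinite words. On infinite words the
    OTW topology is the metric one (nbhs_otw_of): excluding finitely many next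
    letters after a word of length n is a condition on n + 1 letters, and
    excluding none gives back the cylinders that generate the product topology.

    Both parts rest on one description of the OTW topology (nbhs_otwP): the
    generalised cylinders form a base. It holds for finite alphabets too, where
    the OTW-subshift has no finite words. The maps between OTW-subshifts are thus
    treated uniformly, also when one alphabet is finite and the other
    infinite. *)

(** * Letters of finite words *)

Lemma onth_some (T : Type) (w : seq T) i :
  (i < size w)%N -> exists a, onth w i = Some a.
Proof. by elim: w i => // b w IH [|i] /=; [exists b|exact: IH]. Qed.

Lemma nth_onth (T : Type) (d : T) w i a : onth w i = Some a -> nth d w i = a.
Proof. by elim: w i => [|b w IH] [|i] //=; [case|exact: IH]. Qed.

Lemma onth_size (T : Type) (w : seq T) i a :
  onth w i = Some a -> (i < size w)%N.
Proof. by elim: w i => [|b w IH] [|i] //=; exact: IH. Qed.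

Lemma onth_mkseq (T : Type) (x : nat -> T) n i :
  (i < n)%N -> onth (mkseq x n) i = Some (x i).
Proof.
by move=> i_n; rewrite onthE (nth_map (x 0%N)) ?size_mkseq ?nth_mkseq.
Qed.

(** * Neighbourhoods of infinite sequences *)

Lemma seq_dist_lt_expn (R : realType) (A : choiceType) (x y : nat -> A) n :
  (seq_dist R x y < 2 ^- n)%R <-> forall i, (i <= n)%N -> x i = y i.
Proof.
case: (seq_distP R x y) => [[-> ->]|[k [xyk xk ->]]].
  by split=> // _; rewrite invr_gt0 exprn_gt0.
rewrite ltf_pV2 ?posrE ?exprn_gt0// ltr_eXn2l ?ltr1n//; split.
  by move=> nk i /leq_ltn_trans/(_ nk)/xyk.
by move=> xyn; rewrite ltnNge; apply/negP => /xyn.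
Qed.

Lemma nbhs_metric_subshift (R : realType) (A : choiceType) (X : subshift A)
    (x : metric_subshift R X) (U : set (metric_subshift R X)) :
  nbhs x U <->
  exists n, forall y, (forall i, (i < n)%N -> \val x i = \val y i) -> U y.
Proof.
split.
- case=> [_ [[V Vo <-] Vx VU]].
  have : nbhs (\val x : metric_seq R A) V by apply: open_nbhs_nbhs.
  move=> /nbhs_ballP[e /= e0 eV].
  have [n ne] : exists n, (2 ^- n < e)%R.
    have [n] := near_infty_natSinv_expn_lt (PosNum e0).
    by move=> _ /(_ n (leqnn _)) /=; rewrite div1r; exists n.
  exists n.+1 => y xy; apply/VU/eV; rewrite ballEmdist /=.
  by apply: lt_trans ne; apply/seq_dist_lt_expn => i /xy.
- case=> n nU.
  have : nbhs (\val x : metric_seq R A)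
      (ball (\val x : metric_seq R A) (2 ^- n)%R).
    by apply: nbhsx_ballx; rewrite invr_gt0 exprn_gt0.
  move=> /(@initial_continuous (metric_subshift R X) (metric_seq R A)
    set_val x).
  move=> xball; apply: (@filterS _ (nbhs x)) xball => y.
  rewrite /= ballEmdist /= => /seq_dist_lt_expn xy.
  by apply: nU => i /ltnW /xy.
Qed.

(** The OTW-subshift over a finite alphabet is defined through the product
    topology, so this is what compares it with the infinite case. *)
Lemma nbhs_prod_discrete (K : discreteTopologicalType)
    (x : prod_topology (fun _ : nat => K))
    (U : set (prod_topology (fun _ : nat => K))) :
  nbhs x U <-> exists n, forall y, (forall i, (i < n)%N -> x i = y i) -> U y.
Proof.
split.
- pose F : set_system (prod_topology (fun _ : nat => K)) :=
    filter_from setT (fun n => [set y | forall i, (i < n)%N -> x i = y i]).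
  have FF : Filter F.
    apply: filter_from_filter; first by exists 0%N.
    move=> m n _ _; exists (maxn m n) => // y xy.
    by split=> i im; apply: xy; rewrite leq_max im ?orbT.
  suff : F --> x by move=> /[apply] -[n _ nU]; exists n.
  apply/cvg_sup => i V [_ [[W Wo <-] Wx WV]].
  by exists i.+1 => // y xy; apply: WV; rewrite /= -xy.
- case=> n nU.
  suff xn : nbhs x [set y | forall i, (i < n)%N -> x i = y i].
    by apply: (@filterS _ _ (nbhs_filter x)) xn => y; exact: nU.
  elim: n {nU} => [|n IH]; first exact: (@filterE _ _ (nbhs_filter x)).
  have /= xi := @discrete_set1 K (x n).
  have xn := @proj_continuous nat (fun=> K) n x _ xi.
  apply: (@filterS2 _ _ (@nbhs_filter _ x) _ _ _ _ IH xn) => y xy /= yn i.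
  by rewrite ltnS leq_eqVlt => /predU1P[->|/xy].
Qed.

(** * Points and neighbourhoods of an OTW-subshift *)

Section OTWTopology.
Context {A : choiceType} (X : subshift A).

Lemma otw_infP (x : nat -> A) : otw_set X (InfWord x) <-> subshift_set X x.
Proof.
rewrite /otw_set; case: asboolP => _; split.
- by case=> y Xy [<-].
- by move=> Xx; exists x.
- by case=> [[y Xy [<-]]|[]].
- by move=> Xx; left; exists x.
Qed.

(** Over a finite alphabet no word has infinitely many followers, so the two
    cases in the definition of the OTW-subshift have a common description. *)
Lemma otw_finP (w : seq A) : otw_set X (FinWord w) <-> fin_part X w.
Proof.
rewrite /otw_set; case: asboolP => Afin; split.
- by case.
- by case; apply: sub_finite_set Afin.
- by case=> [[]|[v Xv [<-]]].
- by move=> Xw; right; exists w.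
Qed.

(** A finite word of the OTW-subshift has at least one follower, hence every
    point is a prefix of an element of the subshift. This reduces statements on
    the letters of a point to the letters of an infinite sequence. *)
Lemma otw_extension (z : otw X) : exists2 x, subshift_set X x &
  forall i a, xletter (\val z) i = Some a -> x i = a.
Proof.
case: z => -[w|x] /= /set_mem; last first.
  by move=> /otw_infP Xx; exists x => // i a [].
move=> /otw_finP Xw; have [a [y Xy]] := infinite_setN0 Xw.
exists (scat (rcons w a) y) => // i b wi; rewrite /scat.
by rewrite nth_rcons (onth_size wi) (nth_onth _ wi).
Qed.

Lemma otw_finite_alphabet : finite_set [set: A] ->
  forall z : otw X, exists x, \val z = InfWord x.
Proof.
move=> Afin [[w|x] /= /set_mem zX]; last by exists x.
by move/otw_finP: zX; case; apply: sub_finite_set Afin.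
Qed.

Lemma otw_cylinder_language w G (z : otw X) :
  otw_cylinder w G z -> language X w.
Proof.
case=> wz _; have [x Xx zx] := otw_extension z; right; exists x => //.
exists 0%N; apply: (@eq_from_nth _ (x 0%N)); first by rewrite size_mkseq.
move=> i iw; rewrite nth_mkseq// add0n; apply/esym/zx.
have [a wi] := onth_some iw.
by rewrite wz// (nth_onth _ wi).
Qed.

(** Among two cylinders with a common point, the longer word extends the shorter
    one. If it is strictly longer, it already decides the letter that the
    shorter cylinder restricts; if the words agree, the sets of excluded letters
    are united. *)
Lemma otw_cylinderI w1 G1 w2 G2 (z : otw X) : (size w1 <= size w2)%N ->
  finite_set G1 -> finite_set G2 ->
  otw_cylinder w1 G1 z -> otw_cylinder w2 G2 z ->
  exists G, [/\ finite_set G, @otw_cylinder _ X w2 G z &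
    @otw_cylinder _ X w2 G `<=` otw_cylinder w1 G1 `&` otw_cylinder w2 G2].
Proof.
move=> le12 G1fin G2fin [zw1 zG1] [zw2 zG2].
have w1_of z' : xprefix w2 z' -> xprefix w1 z'.
  move=> z'w2 i iw1; have iw2 := leq_trans iw1 le12.
  by rewrite z'w2// -zw2// zw1.
move: le12; rewrite leq_eqVlt => /predU1P[e12|lt12].
  exists (G1 `|` G2); split; first by rewrite finite_setU.
    by split=> // a za [/zG1|/zG2]; apply; rewrite ?e12.
  move=> z' [z'w2 z'G]; split; split => //; first exact: w1_of.
    by move=> a; rewrite e12 => /z'G nG G1a; apply: nG; left.
  by move=> a /z'G nG G2a; apply: nG; right.
exists G2; split=> // z' [z'w2 z'G]; split; split=> //; first exact: w1_of.
by move=> a; rewrite z'w2// -zw2//; exact: zG1.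
Qed.

Lemma open_otw_subbase (U : set (otw X)) : otw_subbase U -> open U.
Proof.
move=> XU; exists [set U]; last by rewrite bigcup_set1.
by move=> _ ->; apply: (@finI_from1 _ _ _ id).
Qed.

(** A nonempty cylinder has its word in the language, which is what the subbase
    requires over an infinite alphabet. *)
Lemma open_otw_cylinder w G : finite_set G -> open (@otw_cylinder _ X w G).
Proof.
move=> Gfin.
have [->|/set0P[z zw]] := eqVneq (@otw_cylinder _ X w G) set0.
  exact: open0.
apply: open_otw_subbase; rewrite /otw_subbase; case: asboolP => Afin.
- exists [set x | xprefix w (InfWord x) /\ ~ G (x (size w))].
    rewrite openE => x [xw xG]; apply/nbhs_prod_discrete.
    exists (size w).+1 => y xy; split; last by rewrite -xy.
    by move=> i iw; rewrite -xw//= xy// ltnS ltnW.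
  apply/seteqP; split => z' /=.
    have [x z'x] := otw_finite_alphabet Afin z'.
    rewrite /otw_cylinder /= z'x => -[xw xG]; exists x => //; split=> //.
    exact: xG.
  move=> [x z'x [xw xG]]; rewrite /otw_cylinder /= z'x; split=> //.
  by move=> a [<-].
- by exists w, G; split=> //; exact: otw_cylinder_language zw.
Qed.

(** The supersets of the cylinders around z form a filter, by otw_cylinderI;
    it suffices that this filter contains the members of the subbase around
    z. *)
Lemma nbhs_otwP (z : otw X) (U : set (otw X)) :
  nbhs z U <->
  exists w G, [/\ finite_set G, otw_cylinder w G z & otw_cylinder w G `<=` U].
Proof.
split; last first.
  move=> [w [G [Gfin zG GU]]]; rewrite nbhsE; exists (otw_cylinder w G) => //.
  by split=> //; apply: open_otw_cylinder.
pose F : set_system (otw X) := [set U | exists w G,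
  [/\ finite_set G, otw_cylinder w G z & otw_cylinder w G `<=` U]].
have FF : Filter F.
  split.
  - exists [::], set0; split=> //; split=> // a _ [].
  - move=> P Q [w1 [G1 [G1fin zG1 G1P]]] [w2 [G2 [G2fin zG2 G2Q]]].
    wlog le12 : P Q w1 w2 G1 G2 G1fin G2fin zG1 zG2 G1P G2Q
        / (size w1 <= size w2)%N.
      move=> H; have [le12|/ltnW le21] := leqP (size w1) (size w2).
        exact: (H P Q w1 w2 G1 G2).
      by rewrite setIC; exact: (H Q P w2 w1 G2 G1).
    have [G [Gfin zG GG]] := otw_cylinderI le12 G1fin G2fin zG1 zG2.
    by exists w2, G; split=> // z' /GG[/G1P ? /G2Q ?].
  - move=> P Q PQ [w [G [Gfin zG GP]]].
    by exists w, G; split=> //; apply: subset_trans PQ.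
suff Fsub V : otw_subbase V -> V z -> F V.
  rewrite nbhsE => -[_ [[B sB <-] [C BC Cz]] BU].
  apply: (@filterS _ F FF _ _ BU); apply: (@filterS _ F FF C).
    by move=> ? ?; exists C.
  have /sB [D sD CE] := BC; rewrite -CE; apply: filter_bigI => E DE.
  apply: Fsub; first by apply/set_mem/sD.
  by move: Cz; rewrite -CE => /(_ _ DE).
rewrite /otw_subbase; case: asboolP => Afin; last first.
  by move=> [w [G [_ Gfin ->]]] zG; exists w, G; split.
move=> [W oW ->] [x zx Wx].
have /nbhs_prod_discrete[n nW] :
    nbhs (x : prod_topology (fun _ : nat => discrete_topology A)) W.
  exact: open_nbhs_nbhs.
exists (mkseq x n), set0; split=> //.
  by split=> [i|a _ []] //; rewrite size_mkseq zx => i_n; rewrite onth_mkseq.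
move=> z' [z'x _]; have [y z'y] := otw_finite_alphabet Afin z'.
exists y => //; apply: nW => i i_n.
have := z'x i; rewrite size_mkseq z'y onth_mkseq// => /(_ i_n)[].
by move->.
Qed.

End OTWTopology.

(** * The infinite words of an OTW-subshift *)

Section Restriction.
Context {R : realType} {A : choiceType} {X : subshift A}.

Lemma otw_of_subproof (x : metric_subshift R X) :
  InfWord (\val x : nat -> A) \in otw_set X.
Proof. by apply/mem_set/otw_infP/set_mem/(valP x). Qed.

Definition otw_of (x : metric_subshift R X) : otw X :=
  exist (fun z => z \in otw_set X) _ (otw_of_subproof x).

Lemma otw_of_inj : injective otw_of.
Proof. by move=> x y [xy]; apply: val_inj. Qed.

Lemma otw_of_shift x : otw_of (metric_shift x) = otw_shift (otw_of x).
Proof. exact: val_inj. Qed.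

Lemma otw_of_surj (z : otw X) :
  xlength (\val z) = None -> exists x, otw_of x = z.
Proof.
case: z => -[//|x] zX _; have Xx := zX.
move: Xx => /set_mem/otw_infP/mem_set Xx.
by exists (exist (fun y : metric_seq R A => y \in _) x Xx); exact: val_inj.
Qed.

(** The inclusion of the infinite words is a topological embedding. *)
Lemma nbhs_otw_of (x : metric_subshift R X) (U : set (metric_subshift R X)) :
  nbhs x U <-> exists2 V, nbhs (otw_of x) V & otw_of @^-1` V `<=` U.
Proof.
split.
- move=> /nbhs_metric_subshift[n nU].
  exists (otw_cylinder (mkseq (\val x) n) set0).
    apply/nbhs_otwP; exists (mkseq (\val x) n), set0; split=> //.
    by split=> [i|a _ []] //; rewrite size_mkseq => i_n; rewrite onth_mkseq.
  move=> y [yx _]; apply: nU => i i_n.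
  by have := yx i; rewrite size_mkseq onth_mkseq// => /(_ i_n)[].
- case=> V /nbhs_otwP[w [G [Gfin [xw xG] GV]]] VU.
  (* One letter more than w has, to control the letter that G excludes. *)
  apply/nbhs_metric_subshift; exists (size w).+1 => y xy; apply/VU/GV; split.
    by move=> i iw; rewrite -xw//= xy// ltnS ltnW.
  by move=> a /= [<-]; apply: xG; rewrite /= xy.
Qed.

End Restriction.

Lemma otw_restriction (R : realType) (A1 A2 : choiceType)
    (X1 : subshift A1) (X2 : subshift A2) (f : otw X1 -> otw X2) :
  continuous f -> (forall z, xlength (\val (f z)) = xlength (\val z)) ->
  exists2 g : metric_subshift R X1 -> metric_subshift R X2,
    continuous g & forall x, otw_of (g x) = f (otw_of x).
Proof.
move=> fcont flen.
have /choice[g gE] (x : metric_subshift R X1) :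
    exists y : metric_subshift R X2, otw_of y = f (otw_of x).
  by apply: otw_of_surj; rewrite flen.
exists g => // x U /nbhs_otw_of[V]; rewrite gE => /fcont fV VU.
apply/nbhs_otw_of; exists (f @^-1` V) => // y; rewrite /= -gE.
exact: VU.
Qed.

Lemma conjugate_of_otw_conjugate (R : realType) (A1 A2 : choiceType)
    (X1 : subshift A1) (X2 : subshift A2) :
  otw_conjugate X1 X2 -> conjugate R X1 X2.
Proof.
case=> F [[Fcont [G [FK GK Gcont]]] Fshift Flen].
have Glen z : xlength (\val (G z)) = xlength (\val z) by rewrite -Flen GK.
have [f fcont fE] := otw_restriction R Fcont Flen.
have [g gcont gE] := otw_restriction R Gcont Glen.
exists f; split.
  split=> //; exists g; split=> // x; apply: otw_of_inj.
    by rewrite gE fE FK.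
  by rewrite fE gE GK.
by move=> x; apply: otw_of_inj; rewrite fE !otw_of_shift Fshift fE.
Qed.

(** * Renaming letters *)

Definition xmap (A B : choiceType) (phi : A -> B) (z : xword A) : xword B :=
  match z with
  | FinWord w => FinWord (map phi w)
  | InfWord x => InfWord (phi \o x)
  end.

Lemma xletter_xmap (A B : choiceType) (phi : A -> B) z i :
  xletter (xmap phi z) i = omap phi (xletter z i).
Proof. by case: z => [w|x] //=; elim: w i => [|a w IH] [|i] /=. Qed.

Lemma xlength_xmap (A B : choiceType) (phi : A -> B) z :
  xlength (xmap phi z) = xlength z.
Proof. by case: z => [w|x] //=; rewrite size_map. Qed.

Lemma xshift_xmap (A B : choiceType) (phi : A -> B) z :
  xshift (xmap phi z) = xmap phi (xshift z).
Proof. by case: z => [[|a w]|x]. Qed.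

Lemma scat_map (A B : choiceType) (phi : A -> B) w y :
  phi \o scat w y = scat (map phi w) (phi \o y).
Proof.
apply/funext => n; rewrite /scat /= size_map.
have [nw|wn] := ltnP n (size w); first by rewrite (nth_map (y (n - size w)%N)).
by rewrite !nth_default// size_map.
Qed.

(** Only letters that occur in X1 are constrained: psi is arbitrary elsewhere,
    so neither map has to be injective on its whole alphabet. *)
Definition letter_morphism (A1 A2 : choiceType) (X1 : subshift A1)
    (X2 : subshift A2) (phi : A1 -> A2) (psi : A2 -> A1) :=
  forall x, subshift_set X1 x ->
    subshift_set X2 (phi \o x) /\ forall n, psi (phi (x n)) = x n.

Section LetterMap.
Context {A1 A2 : choiceType} {X1 : subshift A1} {X2 : subshift A2}.
Context {phi : A1 -> A2} {psi : A2 -> A1}.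
Hypothesis phi_morph : letter_morphism X1 X2 phi psi.

Lemma letter_morphK (z : otw X1) i a :
  xletter (\val z) i = Some a -> psi (phi a) = a.
Proof.
move=> zi; have [x Xx xz] := otw_extension z.
by rewrite -(xz _ _ zi); have [_] := phi_morph Xx.
Qed.

Lemma xmapK (z : otw X1) : xmap psi (xmap phi (\val z)) = \val z.
Proof.
have := @letter_morphK z; case: (\val z) => [w|x] /= wK; congr (_ _).
  rewrite -map_comp -[RHS]map_id.
  elim: w wK => //= a w IH wK; rewrite (wK 0%N a)// IH// => i b wi.
  exact: (wK i.+1).
by apply/funext => i; exact: (wK i).
Qed.

(** As psi undoes phi on the followers of w, the images of infinitely many
    followers are infinitely many followers of the image of w. *)
Lemma fin_part_map w : fin_part X1 w -> fin_part X2 (map phi w).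
Proof.
pose S1 := [set a | exists y, subshift_set X1 (scat (rcons w a) y)].
rewrite /fin_part /= -/S1 => S1inf.
have S1K a : S1 a -> psi (phi a) = a.
  case=> y /phi_morph[_ /(_ (size w))].
  by rewrite /scat nth_rcons ltnn eqxx.
apply: (@sub_infinite_set _ (phi @` S1)).
  move=> _ [a [y /phi_morph[Xy _]] <-]; exists (phi \o y).
  by rewrite -map_rcons -scat_map.
apply: contra_not S1inf => /(finite_image psi); apply: sub_finite_set => a Sa.
by exists (phi a); [exists a | exact: S1K].
Qed.

Lemma xmap_otw (z : otw X1) : xmap phi (\val z) \in otw_set X2.
Proof.
case: z => -[w|x] /= /set_mem zX; apply/mem_set.
  by apply/otw_finP/fin_part_map/otw_finP.
by apply/otw_infP; move/otw_infP: zX => /phi_morph[].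
Qed.

Definition otw_map (z : otw X1) : otw X2 :=
  exist (fun z' => z' \in otw_set X2) _ (xmap_otw z).

(** Around z, the word w pulls back to map psi w. The letters to exclude are
    those sent into G by phi and fixed by psi \o phi: they are finitely many,
    being images under psi of elements of G, and include every occurring letter
    that phi sends into G. *)
Lemma otw_map_continuous : continuous otw_map.
Proof.
move=> z U /nbhs_otwP[w [G [Gfin [zw zG] GU]]].
have vE i : (i < size w)%N -> xletter (\val z) i = onth (map psi w) i.
  move=> iw; rewrite -[LHS]/(xletter _ i) -(xmapK z) xletter_xmap zw//.
  by rewrite -[RHS]/(xletter (xmap psi (FinWord w)) i) xletter_xmap.
apply/nbhs_otwP.
exists (map psi w), [set a | G (phi a) /\ psi (phi a) = a]; split.
- apply: sub_finite_set (finite_image psi Gfin) => a [Ga aE].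
  by exists (phi a).
- split=> [i|a]; rewrite size_map; first exact: vE.
  by move=> za [Ga _]; apply: (zG (phi a)); rewrite //= xletter_xmap za.
- move=> z' [z'v z'G]; apply: GU; split=> [i iw|b].
    rewrite /= xletter_xmap z'v ?size_map// -vE// -xletter_xmap; exact: zw.
  rewrite /= xletter_xmap; case z'a : xletter => [a|] //= [<-] Ga.
  by apply: (z'G a); rewrite ?size_map//; split=> //; exact: letter_morphK z'a.
Qed.

End LetterMap.

Lemma otw_conjugate_of_letter_bijection (A1 A2 : choiceType)
    (X1 : subshift A1) (X2 : subshift A2) (phi : A1 -> A2) (psi : A2 -> A1) :
  letter_morphism X1 X2 phi psi -> letter_morphism X2 X1 psi phi ->
  otw_conjugate X1 X2.
Proof.
move=> phiP psiP; exists (otw_map phiP); split.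
- split; first exact: otw_map_continuous.
  exists (otw_map psiP); split; last exact: otw_map_continuous.
    by move=> z; apply: val_inj; exact: (xmapK phiP z).
  by move=> z; apply: val_inj; exact: (xmapK psiP z).
- by move=> z; apply: val_inj; rewrite /= xshift_xmap.
- by move=> z; rewrite /= xlength_xmap.
Qed.

(** * Isometric conjugacies rename letters *)

Section Isometry.
Context {R : realType} {A1 A2 : choiceType}.
Context {X1 : subshift A1} {X2 : subshift A2}.

(** The first letter of f x depends only on the first letter of x, since sharing
    the first letter means being at distance less than 1; shifting n times
    turns this into a statement on the letter at position n. *)
Lemma isometry_letterwise (f : metric_subshift R X1 -> metric_subshift R X2) :
  [set: A2] !=set0 ->
  (forall x, f (metric_shift x) = metric_shift (f x)) ->
  (forall x y, mdist (\val (f x)) (\val (f y)) = mdist (\val x) (\val y)) ->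
  exists phi, forall x, \val (f x) = phi \o \val x.
Proof.
move=> [b0 _] fshift fiso.
have f0 x y : \val x 0%N = \val y 0%N -> \val (f x) 0%N = \val (f y) 0%N.
  move=> xy.
  apply: (proj1 (@seq_dist_lt_expn R _ (\val (f x)) (\val (f y)) 0)) => //.
  have -> : seq_dist R (\val (f x)) (\val (f y)) =
            seq_dist R (\val x) (\val y).
    exact: fiso.
  by apply/seq_dist_lt_expn => i; rewrite leqn0 => /eqP ->.
have /choice[phi phiE] a :
    exists b, forall x, \val x 0%N = a -> \val (f x) 0%N = b.
  have [[x xa]|nx] := pselect (exists x : metric_subshift R X1, \val x 0%N = a).
    by exists (\val (f x) 0%N) => y ya; apply: f0; rewrite ya.
  (* The value at a letter that does not occur is arbitrary. *)
  by exists b0 => x xa; case: nx; exists x.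
exists phi => x; apply/funext => n /=.
elim: n x => [|n IH] x; first exact: phiE.
by have := IH (metric_shift x); rewrite fshift.
Qed.

End Isometry.

Lemma otw_conjugate_of_isometrically_conjugate (R : realType)
    (A1 A2 : choiceType) (X1 : subshift A1) (X2 : subshift A2) :
  [set: A1] !=set0 -> [set: A2] !=set0 ->
  isometrically_conjugate R X1 X2 -> otw_conjugate X1 X2.
Proof.
move=> A1n A2n [f [[_ [g [fK gK _]]] fshift] fiso].
have gshift y : g (metric_shift y) = metric_shift (g y).
  by rewrite -{1}[y]gK -fshift fK.
have giso x y : mdist (\val (g x)) (\val (g y)) = mdist (\val x) (\val y).
  by rewrite -fiso !gK.
have [phi phiE] := isometry_letterwise A2n fshift fiso.
have [psi psiE] := isometry_letterwise A1n gshift giso.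
apply: (@otw_conjugate_of_letter_bijection _ _ _ _ phi psi).
  move=> x /mem_set Xx.
  pose x' : metric_subshift R X1 :=
    exist (fun y : metric_seq R A1 => y \in _) x Xx.
  rewrite -[phi \o x]/(phi \o \val x') -phiE; split.
    exact/set_mem/(valP (f x')).
  by move=> n; have := psiE (f x'); rewrite fK phiE => /(congr1 (@^~ n)).
move=> x /mem_set Xx.
pose x' : metric_subshift R X2 :=
  exist (fun y : metric_seq R A2 => y \in _) x Xx.
rewrite -[psi \o x]/(psi \o \val x') -psiE; split.
  exact/set_mem/(valP (g x')).
by move=> n; have := phiE (g x'); rewrite gK psiE => /(congr1 (@^~ n)).
Qed.

Theorem theorem6p11 (R : realType) (A1 A2 : choiceType)
    (A1_nonempty : [set: A1] !=set0) (A2_nonempty : [set: A2] !=set0)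
    (A1_countable : countable [set: A1]) (A2_countable : countable [set: A2])
    (X1 : subshift A1) (X2 : subshift A2) :
  (isometrically_conjugate R X1 X2 -> otw_conjugate X1 X2) /\
  (otw_conjugate X1 X2 -> conjugate R X1 X2).
Proof.
split; last exact: conjugate_of_otw_conjugate.
exact: otw_conjugate_of_isometrically_conjugate.
Qed.
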